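(* (Christoffel–Darboux identities.) Let $n\ge0$ and $r,s\in\mathbb{Z}$. (i) Assume $D_m^{(r)}\ne0$ for $1\le m\le n+1$ and $D_n^{(r+2)},D_{n+1}^{(r+2)},D_{n+2}^{(r+2)}\ne0$. Then for all $z_1,z_2\in\mathbb{C}$ with $z_2\neq0$ and $z_1^2\ne z_2^{-2}$, $$K_n(z_2^2,z_1;r)=\frac12\frac{D_n^{(r+2)}}{D_{n+1}^{(r)}}\frac{z_2^{2n+1}}{z_1^2-z_2^{-2}}\det\begin{pmatrix}P_n(-z_2^{-1};r+2)&P_{n+1}(-z_2^{-1};r+2)&P_{n+2}(-z_2^{-1};r+2)\\ P_n(z_2^{-1};r+2)&P_{n+1}(z_2^{-1};r+2)&P_{n+2}(z_2^{-1};r+2)\\ P_n(z_1;r+2)&P_{n+1}(z_1;r+2)&P_{n+2}(z_1;r+2)\end{pmatrix}.$$ (ii) Assume $E_m^{(s)}\ne0$ for $1\le m\le n+1$ and $E_n^{(s-2)},E_{n+1}^{(s-2)},E_{n+2}^{(s-2)}\ne0$. Then for all $z_1,z_2\in\mathbb{C}$ with $z_1\neq0$ and $z_1^{-2}\neq z_2^2$, $$L_n(z_2,z_1^2;s)=\frac12\frac{E_n^{(s-2)}}{E_{n+1}^{(s)}}\frac{z_1^{2n+1}}{z_1^{-2}-z_2^{2}}\det\begin{pmatrix}S_n(z_1^{-1};s-2)&S_{n+1}(z_1^{-1};s-2)&S_{n+2}(z_1^{-1};s-2)\\ S_n(-z_1^{-1};s-2)&S_{n+1}(-z_1^{-1};s-2)&S_{n+2}(-z_1^{-1};s-2)\\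 S_n(z_2;s-2)&S_{n+1}(z_2;s-2)&S_{n+2}(z_2;s-2)\end{pmatrix}.$$
   Context: $\mathbb{T}$ is the unit circle, oriented counterclockwise; $w$ is a complex-valued integrable weight on $\mathbb{T}$ with Fourier coefficients $w_k=\int_{\mathbb{T}}\zeta^{-k}w(\zeta)\frac{d\zeta}{2\pi i\zeta}$. For $n\ge1$, $D_n^{(r)}=\det(w_{r+2j-k})_{0\le j,k\le n-1}$, $E_n^{(s)}=\det(w_{s+j-2k})_{0\le j,k\le n-1}$ ($j$ row index, $k$ column index), $D_0^{(r)}=E_0^{(s)}=1$. When $D_n^{(r)}\ne0$, $P_n(z;r)$ and $Q_n(z;r)$ are the unique monic polynomials of degree $n$ with $\int_{\mathbb{T}}P_n(\zeta;r)\zeta^{-2m-r}w(\zeta)\frac{d\zeta}{2\pi i\zeta}=0$ and $\int_{\mathbb{T}}Q_n(\zeta^{-2};r)\zeta^{m-r}w(\zeta)\frac{d\zeta}{2\pi i\zeta}=0$ for $0\le m\le n-1$; for $m=n$ both integrals equal $h_n^{(r)}=D_{n+1}^{(r)}/D_n^{(r)}$. When $E_n^{(s)}\ne0$, $R_n(z;s)$ and $S_n(z;s)$ are the unique monic polynomials of degree $n$ with $\int_{\mathbb{T}}R_n(\zeta^2;s)\zeta^{-m-s}w(\zeta)\frac{d\zeta}{2\pi i\zeta}=0$ and $\int_{\mathbb{T}}S_n(\zeta^{-1};s)\zeta^{2m-s}w(\zeta)\frac{d\zeta}{2\pi i\zeta}=0$ for $0\le m\le n-1$; for $m=n$ both integrals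 equal $g_n^{(s)}=E_{n+1}^{(s)}/E_n^{(s)}$. Reproducing kernels: $K_n(z,y;r)=\sum_{j=0}^n\frac{1}{h_j^{(r)}}Q_j(z;r)P_j(y;r)$ and $L_n(z,y;s)=\sum_{j=0}^n\frac{1}{g_j^{(s)}}S_j(z;s)R_j(y;s)$. *)

(* Defs.v *)
From HB Require Import structures.
From mathcomp Require Import all_boot all_order all_algebra.
From mathcomp Require Import all_classical all_reals all_analysis.
From mathcomp Require Export complex.

Set Implicit Arguments.
Unset Strict Implicit.
Unset Printing Implicit Defensive.

Import Order.TTheory GRing.Theory Num.Theory.
Import numFieldNormedType.Exports.

Local Open Scope classical_set_scope.
Local Open Scope complex_scope.
Local Open Scope ring_scope.

Section Circle.
Variable R : realType.
Implicit Types f w : R[i] -> R[i].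

Definition expi (t : R) : R[i] := cos t +i* sin t.

Definition circle_integrable f : Prop :=
  (@lebesgue_measure R).-integrable `[0, 2 * pi]
     (fun t => (complex.Re (f (expi t)))%:E) /\
  (@lebesgue_measure R).-integrable `[0, 2 * pi]
     (fun t => (complex.Im (f (expi t)))%:E).

(* \int_T f(zeta) dzeta / (2 pi i zeta): with zeta = e^{it}, dzeta = i zeta dt,
   this is 1/(2 pi) times the integral of f(e^{it}) over 0 <= t <= 2 pi. *)
Definition circle_int f : R[i] :=
  ((2 * pi)^-1 *
     \int[@lebesgue_measure R]_(t in `[0, 2 * pi]) complex.Re (f (expi t))) +i*
  ((2 * pi)^-1 *
     \int[@lebesgue_measure R]_(t in `[0, 2 * pi]) complex.Im (f (expi t))).

Definition fourier_coef w (k : int) : R[i] :=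
  circle_int (fun zeta => zeta ^ (- k) * w zeta).

Definition Ddet w (n : nat) (r : int) : R[i] :=
  \det (\matrix_(j < n, k < n) fourier_coef w (r + 2 * j%:Z - k%:Z)).

Definition Edet w (n : nat) (s : int) : R[i] :=
  \det (\matrix_(j < n, k < n) fourier_coef w (s + j%:Z - 2 * k%:Z)).

Definition hn w (n : nat) (r : int) : R[i] := Ddet w n.+1 r / Ddet w n r.

Definition gn w (n : nat) (s : int) : R[i] := Edet w n.+1 s / Edet w n s.

Definition monic_of_degree (n : nat) (p : {poly R[i]}) : Prop :=
  p \is monic /\ size p = n.+1.

Definition P_spec w (n : nat) (r : int) (p : {poly R[i]}) : Prop :=
  monic_of_degree n p /\
  forall m : nat, (m < n)%N ->
    circle_int (fun zeta => p.[zeta] * zeta ^ (- (2 * m%:Z) - r) * w zeta) = 0.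

Definition Q_spec w (n : nat) (r : int) (p : {poly R[i]}) : Prop :=
  monic_of_degree n p /\
  forall m : nat, (m < n)%N ->
    circle_int (fun zeta => p.[zeta ^- 2] * zeta ^ (m%:Z - r) * w zeta) = 0.

Definition R_spec w (n : nat) (s : int) (p : {poly R[i]}) : Prop :=
  monic_of_degree n p /\
  forall m : nat, (m < n)%N ->
    circle_int (fun zeta => p.[zeta ^+ 2] * zeta ^ (- m%:Z - s) * w zeta) = 0.

Definition S_spec w (n : nat) (s : int) (p : {poly R[i]}) : Prop :=
  monic_of_degree n p /\
  forall m : nat, (m < n)%N ->
    circle_int (fun zeta => p.[zeta^-1] * zeta ^ (2 * m%:Z - s) * w zeta) = 0.

(* For integrable w, P_spec w n r and Q_spec w n r (resp. R_spec w n s and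
   S_spec w n s) have exactly one solution when Ddet w n r != 0 (resp.
   Edet w n s != 0), and xget selects it; otherwise the values below carry no
   meaning. *)
Definition Ppoly w (n : nat) (r : int) : {poly R[i]} :=
  xget 0 [set p | P_spec w n r p].

Definition Qpoly w (n : nat) (r : int) : {poly R[i]} :=
  xget 0 [set p | Q_spec w n r p].

Definition Rpoly w (n : nat) (s : int) : {poly R[i]} :=
  xget 0 [set p | R_spec w n s p].

Definition Spoly w (n : nat) (s : int) : {poly R[i]} :=
  xget 0 [set p | S_spec w n s p].

Definition Kker w (n : nat) (z y : R[i]) (r : int) : R[i] :=
  \sum_(j < n.+1) (hn w j r)^-1 * (Qpoly w j r).[z] * (Ppoly w j r).[y].

Definition Lker w (n : nat) (z y : R[i]) (s : int) : R[i] :=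
  \sum_(j < n.+1) (gn w j s)^-1 * (Spoly w j s).[z] * (Rpoly w j s).[y].

End Circle.

(* Main.v *)
(* Write c k for the Fourier coefficients and <x^j, y^k>_r = c (r + 2j - k), so
   that P_j and Q_j are biorthogonal monic families for <.,.>_r and K_n is its
   reproducing kernel on degrees at most n.  Since
     <f, y^2 g>_(r+2) = <f, g>_r   and   <f, g>_(r+2) = <x f, g>_r,
   the polynomial F(y) = (y^2 - z2^-2) K_n(z2^2, y; r) is orthogonal to
   1, ..., x^(n-1) for <.,.>_(r+2), hence is a combination of P_n, P_(n+1),
   P_(n+2) at r + 2; it vanishes at y = +-1/z2, and its leading coefficient is
   Q_n(z2^2; r) / h_n.  This yields the 3x3 determinant up to the factor
   Q_n(z2^2; r), which a parity argument identifies with a multiple of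
   z2^(2n+1) times the 2x2 minor of P_n, P_(n+1) at +-1/z2.  That factor is
   cancelled as a polynomial in z2, so that its zeros need no separate
   treatment.  The second identity is the first one for the weight with
   coefficients c (- k) and r = - s, with the roles of the two families
   exchanged. *)
Require Import Defs.
From HB Require Import structures.
From mathcomp Require Import all_boot all_order all_algebra.
From mathcomp Require Import all_classical all_reals all_analysis.
From mathcomp Require Import measurable_realfun complex ring lra zify.

Import Order.TTheory GRing.Theory Num.Theory.
Import numFieldNormedType.Exports.
Local Open Scope classical_set_scope.
Local Open Scope complex_scope.
Local Open Scope ring_scope.

Set Implicit Arguments.
Unset Strict Implicit.
Unset Printing Implicit Defensive.

(** * Biorthogonal monic polynomials and their kernel for an arbitrary moment matrix over a field *)

Section Biorthogonal.
Context {F : fieldType}.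
Implicit Types (u : nat -> F) (a : nat -> nat -> F) (p q f : {poly F}).

(** The linear functional whose moments are [u]. For the bilinear form with moments [a j k],
    [pair_seq (a j) p] is the pairing of ['X^j] with [p], and the nested form
    [pair_seq (fun j => pair_seq (a j) p) q] is the pairing of [q] with [p]. *)
Definition pair_seq u p : F := \sum_(k < size p) p`_k * u k.

Lemma pair_seq_wide N u p : (size p <= N)%N ->
  pair_seq u p = \sum_(k < N) p`_k * u k.
Proof.
move=> le_p_N; rewrite /pair_seq (big_ord_widen _ (fun k => p`_k * u k) le_p_N).
rewrite big_mkcond; apply: eq_bigr => k _.
by case: ltnP => // le_p_k; rewrite nth_default ?mul0r.
Qed.

Fact pair_seq_is_linear u : linear_for *%R (pair_seq u).
Proof.
move=> b p q; set N := maxn (size (p : {poly F})) (size (q : {poly F})).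
have le_pN : (size (p : {poly F}) <= N)%N by rewrite leq_maxl.
have le_qN : (size (q : {poly F}) <= N)%N by rewrite leq_maxr.
have le_bN : (size (b *: p + q : {poly F})%R <= N)%N.
  rewrite (leq_trans (size_polyD _ _)) // geq_max le_qN andbT.
  exact: leq_trans (size_scale_leq _ _) le_pN.
rewrite !(@pair_seq_wide N) // mulr_sumr -big_split /=.
by apply: eq_bigr => k _; rewrite coefD coefZ mulrDl mulrA.
Qed.

HB.instance Definition _ u :=
  GRing.isLinear.Build F {poly F} F *%R (pair_seq u) (pair_seq_is_linear u).

Lemma eq_pair_seq u1 u2 p : u1 =1 u2 -> pair_seq u1 p = pair_seq u2 p.
Proof. by move=> eq_u; apply: eq_bigr => k _; rewrite eq_u. Qed.

Lemma pair_seqXn u i : pair_seq u 'X^i = u i.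
Proof.
rewrite /pair_seq size_polyXn big_ord_recr /= coefXn eqxx mul1r.
rewrite big1 ?add0r // => k _.
by rewrite coefXn ltn_eqF ?mul0r // (valP k).
Qed.

Lemma pair_seqMXn u p i :
  pair_seq u (p * 'X^i) = pair_seq (fun k => u (k + i)%N) p.
Proof.
rewrite -{1}[p]coefK poly_def mulr_suml raddf_sum /=.
by apply: eq_bigr => k _; rewrite -scalerAl -exprD linearZ /= pair_seqXn.
Qed.

Lemma exchange_pair_seq a p q :
  pair_seq (fun j => pair_seq (a j) p) q =
  pair_seq (fun k => pair_seq (a^~ k) q) p.
Proof.
rewrite /pair_seq; under eq_bigr do rewrite mulr_sumr.
rewrite exchange_big /=; apply: eq_bigr => k _; rewrite mulr_sumr.
by apply: eq_bigr => j _; rewrite mulrCA.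
Qed.

Definition gram a n : F := \det (\matrix_(j < n, k < n) a j k).

Lemma gram_tr a n : gram (fun j k => a k j) n = gram a n.
Proof.
by rewrite /gram -det_tr; congr (\det _); apply/matrixP => j k; rewrite !mxE.
Qed.

Definition orthogonal_monic a n p :=
  [/\ p \is monic, size p = n.+1 &
      forall m, (m < n)%N -> pair_seq (a m) p = 0].

(** The coefficient vector of [f] lies in the kernel of an invertible Gram matrix. *)
Lemma orthogonal_small_eq0 a n f : gram a n != 0 -> (size f <= n)%N ->
  (forall m, (m < n)%N -> pair_seq (a m) f = 0) -> f = 0.
Proof.
move=> gram_n0 le_f_n f_orth.
have Mf0 : (\matrix_(j < n, k < n) a j k) *m (\col_(k < n) f`_k) = 0.
  apply/matrixP => m l; rewrite !mxE -[RHS](f_orth m) // (pair_seq_wide _ le_f_n).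
  by apply: eq_bigr => k _; rewrite !mxE mulrC.
have f0 : \col_(k < n) f`_k = 0.
  have unitM : \matrix_(j < n, k < n) a j k \in unitmx by rewrite unitmxE unitfE.
  by rewrite -[LHS](mulKmx unitM) Mf0 mulmx0.
apply/polyP => i; rewrite coef0; case: (ltnP i n) => [lt_i_n|le_n_i].
  by have /matrixP/(_ (Ordinal lt_i_n) ord0) := f0; rewrite !mxE.
by rewrite nth_default // (leq_trans le_f_n).
Qed.

Lemma orthogonal_monic_exists a n : gram a n != 0 ->
  exists p, orthogonal_monic a n p.
Proof.
move=> gram_n0; pose M := \matrix_(j < n, k < n) a j k.
have unitM : M \in unitmx by rewrite unitmxE unitfE.
(* [v] solves the system for the coefficients below the leading one. [insub] turns an index into an
   ordinal, and its default 0 is never reached below [n]. *)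
pose v := invmx M *m (\col_(j < n) - a j n).
pose g : {poly F} := \poly_(k < n) (if insub k is Some i then v i ord0 else 0).
have size_g : (size g <= n)%N by apply: size_poly.
have size_p : size ('X^n + g)%R = n.+1.
  by rewrite size_polyDl size_polyXn ?ltnS.
exists ('X^n + g); split=> // [|m lt_mn].
  rewrite monicE lead_coefDl ?size_polyXn ?ltnS //.
  by rewrite lead_coefXn.
rewrite raddfD /= pair_seqXn (pair_seq_wide _ size_g).
have /matrixP/(_ (Ordinal lt_mn) ord0) : M *m v = \col_(j < n) - a j n.
  by rewrite mulKVmx.
rewrite !mxE /= => Mv; rewrite -[X in X + _]opprK -Mv addrC.
apply/eqP; rewrite subr_eq0; apply/eqP; apply: eq_bigr => k _.
by rewrite coef_poly ltn_ord valK !mxE mulrC.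
Qed.

(* Cramer's rule in the system [M_(n+1) p = (0, ..., 0, h)]. *)
Lemma gramS_coef a n p k : orthogonal_monic a n p -> (k <= n)%N ->
  gram a n.+1 * p`_k = pair_seq (a n) p *
    ((-1) ^+ (n + k) * gram (fun i j => a i (bump k j)) n).
Proof.
move=> [_ size_p p_orth] le_kn.
pose M := \matrix_(j < n.+1, k < n.+1) a j k.
pose ik : 'I_n.+1 := Ordinal (le_kn : k < n.+1)%N.
have Mp : M *m (\col_(i < n.+1) p`_i) =
    pair_seq (a n) p *: delta_mx ord_max ord0.
  apply/matrixP => m l; rewrite !mxE ord1 eqxx andbT.
  transitivity (pair_seq (a m) p).
    rewrite /pair_seq size_p; apply: eq_bigr => i _.
    by rewrite !mxE mulrC.
  have [-> | /= m_neq] := eqVneq m ord_max; rewrite ?mulr1 ?mulr0 //.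
  by apply: p_orth; rewrite ltn_neqAle -ltnS ltn_ord andbT.
(* Entry [k] of the product with the adjugate: the left side becomes [\det M] times the coefficient,
   the right side a cofactor along the last row. *)
have := congr1 (fun A => (\adj M *m A) ik ord0) Mp.
rewrite mulmxA mul_adj_mx mul_scalar_mx -scalemxAr !mxE => ->.
congr (_ * _); rewrite (bigD1 ord_max) //= !mxE !eqxx mulr1.
rewrite big1 ?addr0 => [|i /negbTE i_neq]; last by rewrite !mxE i_neq mulr0.
rewrite /cofactor /=; congr (_ * \det _).
by apply/matrixP => i j; rewrite !mxE /= /bump [(n <= i)%N]leqNgt ltn_ord.
Qed.

(** The case [k = n] of [gramS_coef]: the coefficient is 1 and the minor is [gram a n]. Hence the
    norm [h_n] is a ratio of consecutive determinants. *)
Lemma gramS a n p : orthogonal_monic a n p ->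
  gram a n.+1 = pair_seq (a n) p * gram a n.
Proof.
move=> p_orth; have := gramS_coef p_orth (leqnn n).
have [/monicP lead_p size_p _] := p_orth.
move: lead_p; rewrite lead_coefE size_p /= => ->; rewrite mulr1 => ->.
rewrite -signr_odd oddD addbb expr0 mul1r; congr (_ * \det _).
by apply/matrixP => i j; rewrite !mxE /bump leqNgt ltn_ord.
Qed.

(** The case [k = 0] of [gramS_coef], with the norm cancelled through [gramS]. It later fixes the
    normalisation of [Q_n] by its constant term. *)
Lemma orthogonal_monic_coef0 a n p : orthogonal_monic a n p ->
  gram a n.+1 != 0 ->
  gram a n * p`_0 = (-1) ^+ n * gram (fun i j => a i j.+1) n.
Proof.
move=> p_orth gramS_n0; apply: (mulfI gramS_n0).
rewrite mulrCA (gramS_coef p_orth) // mulrA addn0 (gramS p_orth).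
by rewrite [_ * gram a n]mulrC !mulrA.
Qed.


Lemma pair_seq_orthogonal a n p q : orthogonal_monic a n p ->
  (size q <= n.+1)%N ->
  pair_seq (fun j => pair_seq (a j) p) q = q`_n * pair_seq (a n) p.
Proof.
move=> [_ _ p_orth] size_q; rewrite (pair_seq_wide _ size_q) big_ord_recr /=.
by rewrite big1 ?add0r // => k _; rewrite p_orth ?mulr0.
Qed.

(** The kernel as a polynomial in its second variable, the first being fixed at [x]; the norms enter
    as pairings rather than as ratios of determinants. *)
Definition kernel_poly a (P Q : nat -> {poly F}) n x : {poly F} :=
  \sum_(j < n.+1) ((pair_seq (a j) (P j))^-1 * (Q j).[x]) *: P j.

(** Biorthogonality gives the claim for each [Q i], and these span the polynomials of degree at most
    [n]. *)
Lemma kernel_poly_reproducing a (P Q : nat -> {poly F}) n x f :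
  (forall j, (j <= n)%N -> orthogonal_monic a j (P j)) ->
  (forall j, (j <= n)%N -> orthogonal_monic (fun i k => a k i) j (Q j)) ->
  (forall j, (j <= n)%N -> pair_seq (a j) (P j) != 0) ->
  (size f <= n.+1)%N ->
  pair_seq (fun j => pair_seq (a j) (kernel_poly a P Q n x)) f = f.[x].
Proof.
move=> P_orth Q_orth h_n0.
have biorth i j : (i <= n)%N -> (j <= n)%N ->
    pair_seq (fun l => pair_seq (a l) (P j)) (Q i) =
    (pair_seq (a j) (P j)) *+ (i == j).
  move=> le_in le_jn; have [_ size_P _] := P_orth j le_jn.
  have [monic_Q size_Q _] := Q_orth i le_in.
  (* The polynomial of higher degree supplies the orthogonality: [P j] if [i < j], and [Q i], after
     exchanging the two sums, if [j < i]. *)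
  case: (ltngtP i j) => [lt_ij|lt_ji|eq_ij].
  - rewrite (pair_seq_orthogonal (P_orth j le_jn)) ?size_Q ?ltnS 1?ltnW //.
    by rewrite nth_default ?size_Q // mul0r.
  - rewrite exchange_pair_seq (pair_seq_orthogonal (Q_orth i le_in)).
      by rewrite nth_default ?size_P // mul0r.
    by rewrite size_P ltnS ltnW.
  rewrite (pair_seq_orthogonal (P_orth j le_jn)) ?size_Q ?eq_ij //.
  by move/monicP: monic_Q; rewrite lead_coefE size_Q eq_ij => ->; rewrite mul1r.
have reproQ i : (i <= n)%N ->
    pair_seq (fun j => pair_seq (a j) (kernel_poly a P Q n x)) (Q i) = (Q i).[x].
  move=> le_in; under eq_pair_seq do rewrite raddf_sum.
  rewrite /pair_seq; under eq_bigr do rewrite mulr_sumr.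
  rewrite exchange_big /= (bigD1 (Ordinal (le_in : i < n.+1)%N)) //=.
  rewrite [X in _ + X]big1 ?addr0 => [|j j_neq].
    transitivity ((pair_seq (a i) (P i))^-1 * (Q i).[x] *
      pair_seq (fun l => pair_seq (a l) (P i)) (Q i)).
      rewrite {3}/pair_seq mulr_sumr; apply: eq_bigr => k _.
      by rewrite linearZ /= mulrCA.
    by rewrite biorth // eqxx mulr1n mulrAC mulVf ?mul1r ?h_n0.
  transitivity ((pair_seq (a j) (P j))^-1 * (Q j).[x] *
      pair_seq (fun l => pair_seq (a l) (P j)) (Q i)).
    rewrite {2}/pair_seq mulr_sumr; apply: eq_bigr => k _.
    by rewrite linearZ /= mulrCA.
  rewrite biorth ?leq_ord // (_ : (i == j :> nat) = false) ?mulr0n ?mulr0 //.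
  by apply: contraNF j_neq => /eqP eq_ij; rewrite -val_eqE /= eq_ij.
(* Induction on a bound [d] for the size of [f]: subtracting the multiple of [Q d] with the same top
   coefficient lowers the bound. *)
elim: {-2}n.+1 (leqnn n.+1) f => [_ f|d IHd lt_dn f le_fd].
  by rewrite leqn0 size_poly_eq0 => /eqP->; rewrite linear0 horner0.
have [monic_Q size_Q _] := Q_orth d lt_dn.
have le_g : (size (f - f`_d *: Q d)%R <= d)%N.
  apply/leq_sizeP => i; rewrite leq_eqVlt => /predU1P[<-|lt_di].
    move/monicP: monic_Q; rewrite lead_coefE size_Q coefB coefZ => ->.
    by rewrite mulr1 subrr.
  have f_i : f`_i = 0 by apply: nth_default; apply: leq_trans le_fd lt_di.
  by rewrite coefB coefZ f_i (nth_default 0 (s := Q d)) ?size_Q // mulr0 subr0.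
have := IHd (ltnW lt_dn) _ le_g.
rewrite raddfB /= linearZ /= reproQ // hornerD hornerN hornerZ.
by move/eqP; rewrite subr_eq subrK => /eqP.
Qed.

(** Removing the top three coefficients with [p2], [p1], [p0] in turn keeps the orthogonality and
    leaves size at most [n], so the remainder vanishes by [orthogonal_small_eq0]. *)
Lemma orthogonal_tail a n f p0 p1 p2 : gram a n != 0 ->
  orthogonal_monic a n p0 -> orthogonal_monic a n.+1 p1 ->
  orthogonal_monic a n.+2 p2 -> (size f <= n.+3)%N ->
  (forall m, (m < n)%N -> pair_seq (a m) f = 0) ->
  exists b0 b1, f = b0 *: p0 + b1 *: p1 + f`_n.+2 *: p2.
Proof.
move=> gram_n0 [mon0 size0 orth0] [mon1 size1 orth1] [mon2 size2 orth2].
move=> le_f orth_f.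
have lead p d : p \is monic -> size p = d.+1 -> p`_d = 1.
  by move=> /monicP <- size_p; rewrite lead_coefE size_p.
pose f2 := f - f`_n.+2 *: p2; pose f1 := f2 - f2`_n.+1 *: p1.
pose f0 := f1 - f1`_n *: p0.
have drop (g p : {poly F}) d : (size g <= d.+1)%N -> p \is monic -> size p = d.+1 ->
    (size (g - g`_d *: p)%R <= d)%N.
  move=> le_g mon_p size_p.
  apply/leq_sizeP => i; rewrite leq_eqVlt => /predU1P[<-|lt_di].
    by rewrite coefB coefZ (lead p) // mulr1 subrr.
  have g_i : g`_i = 0 by apply: nth_default; apply: leq_trans le_g lt_di.
  by rewrite coefB coefZ g_i (nth_default 0 (s := p)) ?size_p // mulr0 subr0.
have f0_eq0 : f0 = 0.
  apply: (orthogonal_small_eq0 gram_n0).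
    by apply: (drop f1 p0) => //; apply: (drop f2 p1) => //; apply: (drop f p2).
  move=> m lt_mn; rewrite !raddfB /= !linearZ /= orth_f //.
  by rewrite orth0 // orth1 ?(leqW lt_mn) // orth2 ?mulr0 ?subr0 // ltnW // leqW.
exists f1`_n, f2`_n.+1.
by rewrite -[f in LHS](subrK (f`_n.+2 *: p2)) -/f2
  -[f2 in LHS](subrK (f2`_n.+1 *: p1)) -/f1 -[f1 in LHS](subrK (f1`_n *: p0)) -/f0 f0_eq0 add0r.
Qed.

Lemma det3E (g : nat -> nat -> F) :
  \det (\matrix_(i < 3, j < 3) g i j) =
    g 0%N 0%N * (g 1%N 1%N * g 2%N 2%N - g 1%N 2%N * g 2%N 1%N)
  - g 0%N 1%N * (g 1%N 0%N * g 2%N 2%N - g 1%N 2%N * g 2%N 0%N)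
  + g 0%N 2%N * (g 1%N 0%N * g 2%N 1%N - g 1%N 1%N * g 2%N 0%N).
Proof.
rewrite (expand_det_row _ ord0) !big_ord_recl big_ord0 addr0 /cofactor.
rewrite !(expand_det_row _ ord0) !big_ord_recl !big_ord0 !addr0 /cofactor.
rewrite !det_mx11 !mxE /= /bump /= !(addn0, add0n, add1n).
ring.
Qed.

(** Column operations turn [b2] times the third column into the values of [f], namely 0, 0 and
    [f.[y]]; the left side is the expansion along that column. *)
Lemma det3_of_two_zeros p0 p1 p2 b0 b1 b2 (x0 x1 y : F) :
  let f := b0 *: p0 + b1 *: p1 + b2 *: p2 in
  f.[x0] = 0 -> f.[x1] = 0 ->
  f.[y] * (p0.[x0] * p1.[x1] - p1.[x0] * p0.[x1]) =
  b2 * \det (\matrix_(i < 3, j < 3) ([:: p0; p1; p2]`_j).[[:: x0; x1; y]`_i]).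
Proof.
move=> f fu fv; pose g i j := ([:: p0; p1; p2]`_j).[[:: x0; x1; y]`_i].
suff -> : b2 * \det (\matrix_(i < 3, j < 3) g i j) =
    f.[y] * (p0.[x0] * p1.[x1] - p1.[x0] * p0.[x1])
    - f.[x1] * (p0.[x0] * p1.[y] - p1.[x0] * p0.[y])
    + f.[x0] * (p0.[x1] * p1.[y] - p1.[x1] * p0.[y]).
  by rewrite fu fv !mul0r subr0 addr0.
by rewrite det3E /g /f /= !(hornerD, hornerZ); ring.
Qed.

End Biorthogonal.

(** * Moments of the form [c (r + 2j - k)]: the parity argument for [Q_n] and the algebraic
    Christoffel-Darboux identity *)

Section SlitToeplitz.
Context {F : numFieldType}.
Implicit Types (c : int -> F) (r : int) (f g p q : {poly F}).

Definition bimoment c r (j k : nat) : F := c (r + 2 * j%:Z - k%:Z).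

Lemma bimoment_row_shift c r j k :
  bimoment c (r + 2) j k = bimoment c r j.+1 k.
Proof. by congr c; lia. Qed.

Lemma bimoment_col_shift c r j k :
  bimoment c (r + 2) j k.+2 = bimoment c r j k.
Proof. by congr c; lia. Qed.

(** The polynomial whose value at [z ^+ 2] is [z ^+ (2 * n + 1)] times the 2x2 minor of [f], [g] at
    [- z^-1], [z^-1]. The sign factor leaves only odd [a + b], for which the halving and the
    truncated subtractions are exact. *)
Definition parity_wronskian n f g : {poly F} :=
  \sum_(a < n.+1) \sum_(b < n.+2)
    (f`_a * g`_b * ((-1) ^+ a - (-1) ^+ b)) *: 'X^((2 * n + 1 - a - b)./2).

Lemma size_parity_wronskian n f g : (size (parity_wronskian n f g) <= n.+1)%N.
Proof.
apply: leq_trans (size_sum _ _ _) _; apply/bigmax_leqP => a _.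
apply: leq_trans (size_sum _ _ _) _; apply/bigmax_leqP => b _.
apply: leq_trans (size_scale_leq _ _) _; rewrite size_polyXn ltnS; lia.
Qed.

Lemma signrB_even (a b : nat) :
  (~~ odd (a + b)) -> (-1) ^+ a - (-1) ^+ b = 0 :> F.
Proof.
rewrite oddD negb_add => /eqP par.
by rewrite -signr_odd par signr_odd subrr.
Qed.

Lemma horner_parity_wronskian n f g z : z != 0 ->
  (size f <= n.+1)%N -> (size g <= n.+2)%N ->
  (parity_wronskian n f g).[z ^+ 2] =
  z ^+ (2 * n + 1) * (f.[- z^-1] * g.[z^-1] - g.[- z^-1] * f.[z^-1]).
Proof.
move=> z_n0 size_f size_g.
rewrite !(horner_coef_wide _ size_f) !(horner_coef_wide _ size_g).
rewrite [X in _ - X]mulrC !big_distrlr /= -sumrB mulr_sumr horner_sum.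
apply: eq_bigr => a _; rewrite -sumrB mulr_sumr horner_sum.
apply: eq_bigr => b _; rewrite hornerZ hornerXn.
have [odd_ab|even_ab] := boolP (odd (a + b)); last first.
  rewrite signrB_even // mulr0 mul0r.
  have := signrB_even even_ab; rewrite !(exprNn z^-1) => /subr0_eq ->; ring.
have -> : (z ^+ 2) ^+ (2 * n + 1 - a - b)./2 =
    z ^+ (2 * n + 1) * z^-1 ^+ a * z^-1 ^+ b.
  have le_ab : (a + b <= 2 * n + 1)%N by have := ltn_ord a; have := ltn_ord b; lia.
  rewrite -exprM -mulrA -exprD exprVn -expfB_cond; last first.
    by rewrite (negbTE z_n0) add0n.
  by congr (_ ^+ _); lia.
rewrite !(exprNn z^-1); ring.
Qed.

(** Among odd [a + b], the exponent is zero only when [a + b = 2n + 1], that is [a = n] and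
    [b = n + 1]. *)
Lemma coef0_parity_wronskian n f g :
  (parity_wronskian n f g)`_0 = f`_n * g`_n.+1 * (2 * (-1) ^+ n).
Proof.
rewrite coef_sum big_ord_recr /= big1 ?add0r => [|a _]; last first.
  rewrite coef_sum big1 // => b _; rewrite coefZ coefXn.
  have [odd_ab|even_ab] := boolP (odd (a + b)); last first.
    by rewrite signrB_even // mulr0 mul0r.
  by rewrite (_ : (_ == _) = false) ?mulr0 //; have := ltn_ord a; have := ltn_ord b; lia.
rewrite coef_sum big_ord_recr /= big1 ?add0r => [|b _]; last first.
  rewrite coefZ coefXn.
  have [odd_ab|even_ab] := boolP (odd (n + b)); last first.
    by rewrite signrB_even // mulr0 mul0r.
  by rewrite (_ : (_ == _) = false) ?mulr0 //; have := ltn_ord b; lia.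
rewrite coefZ coefXn (_ : (_ == _) = true) ?mulr1; last by lia.
by rewrite exprS; ring.
Qed.

(* With [e = (-1)^m], orthogonality kills the row sums for [a] and the column
   sums for [b] of opposite parity to [m], that is, all row sums weighted by
   [1 - e (-1)^a] and all column sums weighted by [1 - e (-1)^b]; the difference
   of the two weights is [- e ((-1)^a - (-1)^b)]. *)
Lemma parity_wronskian_orthogonal c r n f g m :
  orthogonal_monic (bimoment c (r + 2)) n f ->
  orthogonal_monic (bimoment c (r + 2)) n.+1 g -> (m < n)%N ->
  pair_seq (bimoment c r ^~ m) (parity_wronskian n f g) = 0.
Proof.
move=> [_ size_f f_orth] [_ size_g g_orth] lt_mn.
pose u (a b : nat) := f`_a * g`_b * c (r + (2 * n + 1)%N%:Z - m%:Z - a%:Z - b%:Z).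
have -> : pair_seq (bimoment c r ^~ m) (parity_wronskian n f g) =
    \sum_(a < n.+1) \sum_(b < n.+2) ((-1) ^+ a - (-1) ^+ b) * u a b.
  rewrite raddf_sum /=; apply: eq_bigr => a _; rewrite raddf_sum /=.
  apply: eq_bigr => b _; rewrite linearZ /= pair_seqXn.
  have [odd_ab|even_ab] := boolP (odd (a + b)); last first.
    by rewrite signrB_even // mulr0 !mul0r.
  rewrite /u /bimoment [_ * (_ - _)]mulrC -[LHS]mulrA; congr (_ * (_ * c _)).
  by have := ltn_ord a; have := ltn_ord b; lia.
(* This sum is the coefficient of [f] at [a] times the pairing at [r + 2] of ['X^j] with [g], where
   [2j = 2n - 1 - m - a]; the parity of [a + m] makes [j] an integer. *)
have sum_b a : (a < n.+1)%N -> odd (a + m) -> \sum_(b < n.+2) u a b = 0.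
  move=> lt_an odd_am.
  have lt_jn : (((2 * n - 1 - m - a)./2) < n.+1)%N by lia.
  rewrite -[RHS](mulr0 f`_a) -[X in _ = _ * X](g_orth _ lt_jn).
  rewrite /pair_seq size_g mulr_sumr.
  apply: eq_bigr => b _; rewrite /u /bimoment -mulrA; congr (_ * (_ * c _)); lia.
(* Here [b + m] can reach [2n], but its oddness excludes that value, so the truncated subtraction is
   again exact. *)
have sum_a b : (b < n.+2)%N -> odd (b + m) -> \sum_(a < n.+1) u a b = 0.
  move=> lt_bn odd_bm.
  have lt_jn : (((2 * n - 1 - m - b)./2) < n)%N by lia.
  rewrite -[RHS](mulr0 g`_b) -[X in _ = _ * X](f_orth _ lt_jn).
  rewrite /pair_seq size_f mulr_sumr.
  apply: eq_bigr => a _; rewrite /u /bimoment -mulrA mulrCA; congr (_ * (_ * c _)); lia.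
have sign1 k : ~~ odd (k + m) -> (1 - (-1) ^+ m * (-1) ^+ k : F) = 0.
  by rewrite -exprD addnC -signr_odd => /negbTE->; rewrite subrr.
have rows : \sum_(a < n.+1) \sum_(b < n.+2) (1 - (-1) ^+ m * (-1) ^+ a) * u a b = 0.
  apply: big1 => a _; rewrite -mulr_sumr.
  by have [/sum_b->|/sign1->] := boolP (odd (a + m)); rewrite ?mulr0 ?mul0r.
have cols : \sum_(a < n.+1) \sum_(b < n.+2) (1 - (-1) ^+ m * (-1) ^+ b) * u a b = 0.
  rewrite exchange_big /=; apply: big1 => b _; rewrite -mulr_sumr.
  by have [/sum_a->|/sign1->] := boolP (odd (b + m)); rewrite ?mulr0 ?mul0r.
apply: (mulfI (_ : (-1) ^+ m != 0)); first by rewrite signr_eq0.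
rewrite mulr0 -[RHS](subrr 0) -[X in _ = X - _]cols -[X in _ = _ - X]rows.
rewrite -sumrB mulr_sumr.
apply: eq_bigr => a _; rewrite -sumrB mulr_sumr.
by apply: eq_bigr => b _; ring.
Qed.

Lemma gram_bimoment_shift c r n :
  gram (fun i j => bimoment c r j.+1 i) n = gram (bimoment c (r + 2)) n.
Proof.
rewrite -gram_tr; congr (\det _); apply/matrixP => j k; rewrite !mxE.
by rewrite bimoment_row_shift.
Qed.

(** Both polynomials have degree at most [n] and are killed by the same [n] functionals, hence are
    proportional. The factor comes from the constant terms: [2 * (-1) ^+ n] for the wronskian, and
    [orthogonal_monic_coef0] for [q]. *)
Lemma parity_wronskianE c r n f g q :
  gram (bimoment c r) n != 0 -> gram (bimoment c r) n.+1 != 0 ->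
  orthogonal_monic (bimoment c (r + 2)) n f ->
  orthogonal_monic (bimoment c (r + 2)) n.+1 g ->
  orthogonal_monic (fun j k => bimoment c r k j) n q ->
  gram (bimoment c (r + 2)) n *: parity_wronskian n f g =
  (2 * gram (bimoment c r) n) *: q.
Proof.
move=> gram_n0 gramS_n0 f_orth g_orth q_orth.
pose T := parity_wronskian n f g; have [/monicP lead_q size_q q_pair] := q_orth.
have [/monicP lead_f size_f _] := f_orth.
have [/monicP lead_g size_g _] := g_orth.
have Tq : T = T`_n *: q.
  apply/eqP; rewrite -subr_eq0; apply/eqP.
  apply: (@orthogonal_small_eq0 _ (fun j k => bimoment c r k j) n).
  - by rewrite gram_tr.
  - apply/leq_sizeP => i; rewrite leq_eqVlt => /predU1P[<-|lt_ni].
      move: lead_q; rewrite lead_coefE size_q /= => q_n.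
      by rewrite coefB coefZ q_n mulr1 subrr.
    have T_i : T`_i = 0.
      by apply: nth_default; apply: leq_trans (size_parity_wronskian _ _ _) lt_ni.
    by rewrite coefB coefZ T_i (nth_default 0 (s := q)) ?size_q // mulr0 subr0.
  move=> m lt_mn; rewrite raddfB /= linearZ /= q_pair // mulr0 subr0.
  exact: parity_wronskian_orthogonal f_orth g_orth lt_mn.
have q0 : gram (bimoment c r) n * q`_0 =
    (-1) ^+ n * gram (bimoment c (r + 2)) n.
  rewrite -(gram_tr (bimoment c r)) (orthogonal_monic_coef0 q_orth).
    by rewrite gram_bimoment_shift.
  by rewrite gram_tr.
have T0 : T`_n * q`_0 = 2 * (-1) ^+ n.
  rewrite -coefZ -Tq coef0_parity_wronskian.
  move: lead_f lead_g; rewrite !lead_coefE size_f size_g /= => -> ->.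
  by rewrite !mul1r.
rewrite -/T Tq scalerA; congr (_ *: _).
apply: (mulfI (_ : (-1) ^+ n != 0)); first by rewrite signr_eq0.
rewrite mulrA -q0 -mulrA [X in _ * X]mulrC T0; ring.
Qed.

(** In characteristic zero the points 1, 2, ..., [size p] are distinct and nonzero, which is more
    roots than the degree allows. *)
Lemma poly_eq0_off0 p : (forall z, z != 0 -> p.[z] = 0) -> p = 0.
Proof.
move=> p0; pose s := [seq i.+1%:R : F | i <- iota 0 (size p)].
apply: (@roots_geq_poly_eq0 _ p s).
- by apply/allP => _ /mapP[i _ ->]; rewrite rootE p0 // pnatr_eq0.
- rewrite map_inj_uniq ?iota_uniq // => i j /eqP.
  by rewrite eqr_nat eqSS => /eqP.
by rewrite size_map size_iota.
Qed.

(** Clears the denominators of [p.[e * z^-1]], so that an identity in [z^-1] becomes one between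
    polynomials in [z]. *)
Lemma reversed_horner p N e : (size p <= N.+1)%N ->
  exists q, forall z, z != 0 -> q.[z] = z ^+ N * p.[e * z^-1].
Proof.
move=> size_p; exists (\sum_(k < N.+1) (p`_k * e ^+ k) *: 'X^(N - k)) => z z_n0.
rewrite (horner_coef_wide _ size_p) mulr_sumr horner_sum.
apply: eq_bigr => k _; rewrite hornerZ hornerXn exprMn exprVn.
have le_kN : (k <= N)%N by rewrite -ltnS.
have -> : z ^+ N = z ^+ (N - k) * z ^+ k by rewrite -exprD subnK.
by field; rewrite expf_neq0.
Qed.

(** Stated for an arbitrary sequence [c], so that both halves of the theorem are instances of it. *)
Lemma christoffel_darboux c r n (P Q : nat -> {poly F}) p0 p1 p2 (z1 z2 : F) :
  (forall m, (m <= n.+1)%N -> gram (bimoment c r) m != 0) ->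
  gram (bimoment c (r + 2)) n != 0 ->
  (forall j, (j <= n)%N -> orthogonal_monic (bimoment c r) j (P j)) ->
  (forall j, (j <= n)%N ->
    orthogonal_monic (fun j k => bimoment c r k j) j (Q j)) ->
  orthogonal_monic (bimoment c (r + 2)) n p0 ->
  orthogonal_monic (bimoment c (r + 2)) n.+1 p1 ->
  orthogonal_monic (bimoment c (r + 2)) n.+2 p2 ->
  z2 != 0 -> z1 ^+ 2 != z2 ^- 2 ->
  \sum_(j < n.+1) (gram (bimoment c r) j.+1 / gram (bimoment c r) j)^-1 *
      (Q j).[z2 ^+ 2] * (P j).[z1] =
  2^-1 * (gram (bimoment c (r + 2)) n / gram (bimoment c r) n.+1)
  * (z2 ^+ (2 * n + 1) / (z1 ^+ 2 - z2 ^- 2))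
  * \det (\matrix_(i < 3, j < 3)
            ([:: p0; p1; p2]`_j).[[:: - z2^-1; z2^-1; z1]`_i]).
Proof.
move=> gram_n0 gram'_n0 P_orth Q_orth p0_orth p1_orth p2_orth z2_n0 z12.
set g := gram (bimoment c r); set g'n := gram _ n.
pose h j := pair_seq (bimoment c r j) (P j).
have hE j : (j <= n)%N -> h j = g j.+1 / g j.
  move=> le_jn; rewrite /g (gramS (P_orth j le_jn)) mulfK //.
  by rewrite gram_n0 // leqW.
have h_n0 j : (j <= n)%N -> h j != 0.
  move=> le_jn; rewrite hE // mulf_neq0 ?invr_eq0 ?gram_n0 //.
  by rewrite leqW.
have lead1 a d p : orthogonal_monic a d p -> p`_d = 1.
  by case=> /monicP <- size_p _; rewrite lead_coefE size_p.
(* The point [z2] is replaced by a variable [z], so that [Q_n(z^2)] can later be cancelled as a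
   polynomial. *)
pose K z := (kernel_poly (bimoment c r) P Q n (z ^+ 2)).
have size_K z : (size (K z) <= n.+1)%N.
  apply: leq_trans (size_sum _ _ _) _; apply/bigmax_leqP => j _.
  apply: leq_trans (size_scale_leq _ _) _.
  by have [_ -> _] := P_orth j (leq_ord j).
have K_n z : (K z)`_n = (h n)^-1 * (Q n).[z ^+ 2].
  rewrite coef_sum big_ord_recr /= big1 ?add0r => [|j _].
    by rewrite coefZ (lead1 _ _ _ (P_orth n _)) // mulr1.
  have [_ size_P _] := P_orth j (ltnW (ltn_ord j)).
  by rewrite coefZ nth_default ?mulr0 // size_P.
have K_pair z m : (m <= n)%N ->
    pair_seq (bimoment c r m) (K z) = z ^+ (2 * m).
  move=> le_mn; rewrite exprM -hornerXn.
  rewrite -(kernel_poly_reproducing (a := bimoment c r) (P := P) (Q := Q) (n := n)) //.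
    by rewrite pair_seqXn.
  by rewrite size_polyXn.
pose u z : {poly F} := K z * 'X^2 - z ^- 2 *: K z.
pose D z := \det (\matrix_(i < 3, j < 3)
  ([:: p0; p1; p2]`_j).[[:: - z^-1; z^-1; z1]`_i]).
have u_horner z y : (u z).[y] = (y ^+ 2 - z ^- 2) * (K z).[y].
  by rewrite /u hornerD hornerN hornerM hornerXn hornerZ; ring.
have u_det z : z != 0 ->
    (z1 ^+ 2 - z ^- 2) * (K z).[z1] *
      (p0.[- z^-1] * p1.[z^-1] - p1.[- z^-1] * p0.[z^-1]) =
    (h n)^-1 * (Q n).[z ^+ 2] * D z.
  move=> z_n0.
  (* The two shifts turn the pairings at [r + 2] into pairings at [r], with values [z ^+ (2 * m)]
     and [z ^- 2 * z ^+ (2 * m.+1)]; these cancel, and [m < n] keeps [m.+1] within reach of the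
     kernel. *)
  have u_orth m : (m < n)%N -> pair_seq (bimoment c (r + 2) m) (u z) = 0.
    move=> lt_mn; rewrite raddfB /= linearZ /= pair_seqMXn.
    under eq_pair_seq do rewrite addn2 bimoment_col_shift.
    rewrite (eq_pair_seq (u1 := bimoment c (r + 2) m) _ (bimoment_row_shift c r m)).
    rewrite !K_pair ?(ltnW lt_mn) // mulnS exprD -exprVn mulrA -exprMn mulVf //.
    by rewrite expr1n mul1r subrr.
  have size_u : (size (u z) <= n.+3)%N.
    apply: leq_trans (size_polyD _ _) _; rewrite geq_max size_polyN.
    apply/andP; split.
      apply: leq_trans (size_polyMleq _ _) _.
      by rewrite size_polyXn addn3 /= !ltnS.
    by apply: leq_trans (size_scale_leq _ _) _; apply: leq_trans (size_K z) _; lia.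
  have u_lead : (u z)`_n.+2 = (h n)^-1 * (Q n).[z ^+ 2].
    rewrite coefB coefZ coefMXn /= subn2 /= K_n.
    rewrite (nth_default 0 (s := K z)) ?mulr0 ?subr0 //.
    exact: leq_trans (size_K z) (leqnSn _).
  have [b0 [b1 uE]] :=
    orthogonal_tail gram'_n0 p0_orth p1_orth p2_orth size_u u_orth.
  rewrite -u_horner -u_lead {1}uE; apply: det3_of_two_zeros; rewrite -uE u_horner.
    by rewrite sqrrN exprVn subrr mul0r.
  by rewrite exprVn subrr mul0r.
have wronsk z : z != 0 ->
    g'n * (z ^+ (2 * n + 1) * (p0.[- z^-1] * p1.[z^-1] - p1.[- z^-1] * p0.[z^-1]))
    = 2 * g n * (Q n).[z ^+ 2].
  move=> z_n0; have [_ size0 _] := p0_orth; have [_ size1 _] := p1_orth.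
  rewrite -horner_parity_wronskian ?size0 ?size1 // -!hornerZ.
  rewrite (parity_wronskianE (q := Q n) _ _ p0_orth p1_orth) ?gram_n0 //.
  exact: Q_orth.
(* Multiplying [u_det] by [g'n * z ^+ (2 * n + 1)] and inserting [wronsk] leaves [Q_n(z^2)] as a
   common factor. *)
have key z : z != 0 ->
    ((z1 ^+ 2 - z ^- 2) * (K z).[z1]
     - 2^-1 * (g'n / g n.+1) * z ^+ (2 * n + 1) * D z) * (Q n).[z ^+ 2] = 0.
  move=> z_n0; have gn0 := gram_n0 n (leqnSn n); have gSn0 := gram_n0 n.+1 (leqnn _).
  have /(congr1 (fun x => x * (g'n * z ^+ (2 * n + 1)))) := u_det z z_n0.
  rewrite hE //.
  set W := p0.[_] * _ - _.
  move=> E; have {}E : (z1 ^+ 2 - z ^- 2) * (K z).[z1] *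
      (g'n * (z ^+ (2 * n + 1) * W)) =
    (g n.+1 / g n)^-1 * (Q n).[z ^+ 2] * D z * (g'n * z ^+ (2 * n + 1)).
    by rewrite -E; ring.
  rewrite wronsk // in E.
  apply: (mulfI (_ : 2 * g n != 0)); first by rewrite mulf_neq0 ?pnatr_eq0.
  rewrite mulr0; apply/eqP; rewrite mulrA mulrBr mulrBl subr_eq0; apply/eqP.
  transitivity ((z1 ^+ 2 - z ^- 2) * (K z).[z1] * (2 * g n * (Q n).[z ^+ 2])).
    by ring.
  rewrite E; field.
  by rewrite gn0 gSn0.
have KE z : (K z).[z1] =
    \sum_(j < n.+1) (g j.+1 / g j)^-1 * (Q j).[z ^+ 2] * (P j).[z1].
  rewrite horner_sum; apply: eq_bigr => j _.
  by rewrite hornerZ -hE ?leq_ord.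
have [_ size0 _] := p0_orth; have [_ size1 _] := p1_orth.
have [_ size2 _] := p2_orth.
have rev p e : (size p <= n.+3)%N ->
  exists q, forall z, z != 0 -> q.[z] = z ^+ n.+2 * p.[e * z^-1].
  exact: reversed_horner.
have [m0 m0E] := rev p0 (-1) ltac:(by rewrite size0; lia).
have [m1 m1E] := rev p1 (-1) ltac:(by rewrite size1; lia).
have [m2 m2E] := rev p2 (-1) ltac:(by rewrite size2; lia).
have [l0 l0E] := rev p0 1 ltac:(by rewrite size0; lia).
have [l1 l1E] := rev p1 1 ltac:(by rewrite size1; lia).
have [l2 l2E] := rev p2 1 ltac:(by rewrite size2; lia).
(* Both sides of the identity times [z ^+ 3]: on the right, two reversed polynomials contribute
   [2 * (n + 2) = (2 * n + 1) + 3] powers of [z]. *)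
pose qL : {poly F} := 'X * (z1 ^+ 2 *: 'X^2 - 1) *
  \sum_(j < n.+1) ((g j.+1 / g j)^-1 * (P j).[z1]) *: (Q j \Po 'X^2).
pose qR : {poly F} := (2^-1 * (g'n / g n.+1)) *:
  (p2.[z1] *: (m0 * l1 - m1 * l0) - p1.[z1] *: (m0 * l2 - m2 * l0)
   + p0.[z1] *: (m1 * l2 - m2 * l1)).
have qLE z : z != 0 ->
    qL.[z] = z ^+ 3 * ((z1 ^+ 2 - z ^- 2) * (K z).[z1]).
  move=> z_n0; rewrite /qL !hornerM hornerX hornerD hornerN hornerZ hornerXn hornerC.
  have -> : (K z).[z1] =
      (\sum_(j < n.+1) ((g j.+1 / g j)^-1 * (P j).[z1]) *: (Q j \Po 'X^2)).[z].
    rewrite KE horner_sum; apply: eq_bigr => j _.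
    by rewrite hornerZ horner_comp hornerXn mulrAC.
  by field.
have qRE z : z != 0 ->
    qR.[z] = z ^+ 3 * (2^-1 * (g'n / g n.+1) * z ^+ (2 * n + 1) * D z).
  move=> z_n0.
  rewrite /D (det3E (fun i j => ([:: p0; p1; p2]`_j).[[:: - z^-1; z^-1; z1]`_i])) /=.
  rewrite /qR !(hornerZ, hornerD, hornerN, hornerM).
  rewrite m0E // m1E // m2E // l0E // l1E // l2E //.
  rewrite !mul1r !mulN1r.
  have -> : z ^+ (2 * n + 1) = z ^+ n * z ^+ n * z.
    by rewrite -exprD -exprSr; congr (_ ^+ _); lia.
  by rewrite !exprS; field; apply: gram_n0.
have qLR : qL = qR.
  apply/eqP; rewrite -subr_eq0; apply/eqP.
  (* [Q_n] is monic, so its composite with ['X^2] is a nonzero polynomial and can be cancelled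
     whatever its zeros are. *)
  have Qn0 : (Q n \Po 'X^2) != 0.
    rewrite comp_poly_eq0 ?size_polyXn //.
    by have [/monic_neq0] := Q_orth n (leqnn n).
  apply: (mulIf Qn0); rewrite mul0r; apply: poly_eq0_off0 => z z_n0.
  rewrite hornerM horner_comp hornerXn hornerD hornerN qLE // qRE //.
  by rewrite -mulrBr -[LHS]mulrA key // mulr0.
have := congr1 (fun q => q.[z2]) qLR; rewrite /= qLE // qRE // => /mulfI.
rewrite expf_neq0 // -KE => /(_ isT) E.
have d_n0 : z1 ^+ 2 - z2 ^- 2 != 0 by rewrite subr_eq0.
apply: (mulfI d_n0); rewrite E -/(D z2).
rewrite -[in LHS](divfK d_n0 (z2 ^+ (2 * n + 1))).
ring.
Qed.

End SlitToeplitz.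

(** * Linearity of the circle integral and its evaluation by Fourier coefficients *)

Section CircleIntegral.
Context {R : realType}.
Implicit Types (f g h w : R[i] -> R[i]) (p : {poly R[i]}).

Local Notation mu := (@lebesgue_measure R).
Local Notation D := (`[0, 2 * pi]%classic : set R).

Lemma expi_neq0 (t : R) : expi t != 0.
Proof.
apply/eqP => -[cos0 sin0]; have := cos2Dsin2 t.
by rewrite cos0 sin0 expr0n addr0 => /eqP; rewrite eq_sym oner_eq0.
Qed.

Lemma expiV (t : R) : (expi t)^-1 = cos t -i* sin t.
Proof.
apply: (mulfI (expi_neq0 t)); rewrite mulfV ?expi_neq0 //.
apply/eqP; rewrite eq_complex /=; apply/andP; split; apply/eqP.
  by rewrite mulrN opprK -!expr2 cos2Dsin2.
by rewrite mulrN mulrC addNr.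
Qed.

Lemma eq_circle_int f g : (forall t : R, f (expi t) = g (expi t)) ->
  circle_int f = circle_int g.
Proof.
by move=> fg; congr ((_ * _) +i* (_ * _)); apply: eq_Rintegral => t _; rewrite fg.
Qed.

Lemma eq_circle_integrable f g : (forall t : R, f (expi t) = g (expi t)) ->
  circle_integrable f -> circle_integrable g.
Proof.
move=> fg [fr fi]; split; [apply: eq_integrable fr | apply: eq_integrable fi] => //.
  by move=> t _; rewrite fg.
by move=> t _; rewrite fg.
Qed.

Lemma circle_integrable0 : circle_integrable (fun=> 0 : R[i]).
Proof. by split; apply: integrable0. Qed.

Lemma circle_integrableD f g : circle_integrable f -> circle_integrable g ->
  circle_integrable (fun z => f z + g z).
Proof.
move=> [fr fi] [gr gi]; split.
  by under [X in integrable _ _ X]eq_fun do rewrite raddfD EFinD; apply: integrableD.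
by under [X in integrable _ _ X]eq_fun do rewrite raddfD EFinD; apply: integrableD.
Qed.

Lemma circle_intD f g : circle_integrable f -> circle_integrable g ->
  circle_int (fun z => f z + g z) = circle_int f + circle_int g.
Proof.
move=> [fr fi] [gr gi]; rewrite /circle_int.
under eq_Rintegral do rewrite raddfD.
under [X in _ +i* (_ * X)]eq_Rintegral do rewrite raddfD.
by rewrite !RintegralD // !mulrDr.
Qed.

(** The real and imaginary parts of the product are sums or differences of products of a bounded
    continuous function with an integrable one. *)
Lemma circle_integrableM h f :
  continuous (fun t => complex.Re (h (expi t))) ->
  continuous (fun t => complex.Im (h (expi t))) ->
  (exists M, forall t,
    `|complex.Re (h (expi t))| <= M /\ `|complex.Im (h (expi t))| <= M) ->
  circle_integrable f -> circle_integrable (fun z => h z * f z).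
Proof.
move=> hr_cont hi_cont [M hM] [fr fi].
have mD : measurable D by [].
have prod (k v : R -> R) : continuous k -> (forall t, `|k t| <= M) ->
    mu.-integrable D (fun t => (v t)%:E) ->
    mu.-integrable D (fun t => (k t * v t)%:E).
  move=> k_cont k_M v_int.
  apply: (@integrableMr _ _ _ mu D mD k (fun t => (v t)%:E)) => //.
    by apply: measurable_funTS; apply: continuous_measurable_fun.
  exists M; split; first exact: num_real.
  by move=> N lt_MN t _; apply: le_trans (k_M t) (ltW lt_MN).
split.
  rewrite [X in integrable _ _ X](_ : _ = fun t =>
    ((complex.Re (h (expi t)) * complex.Re (f (expi t)))%:E -
     (complex.Im (h (expi t)) * complex.Im (f (expi t)))%:E)%E).
    by apply: integrableB => //; apply: prod => // t; case: (hM t).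
  by apply/funext => t; case: (h _) (f _) => [a b] [x y].
rewrite [X in integrable _ _ X](_ : _ = fun t =>
    ((complex.Re (h (expi t)) * complex.Im (f (expi t)))%:E +
     (complex.Im (h (expi t)) * complex.Re (f (expi t)))%:E)%E).
  by apply: integrableD => //; apply: prod => // t; case: (hM t).
by apply/funext => t; case: (h _) (f _) => [a b] [x y].
Qed.

Lemma circle_integrableZ a f : circle_integrable f ->
  circle_integrable (fun z => a * f z).
Proof.
apply: (circle_integrableM (h := fun=> a)); try exact: cst_continuous.
by exists (Num.max `|complex.Re a| `|complex.Im a|) => t; rewrite !le_max !lexx orbT.
Qed.

Lemma circle_intZ a f : circle_integrable f ->
  circle_int (fun z => a * f z) = a * circle_int f.
Proof.
move=> [fr fi]; case: a => x y; rewrite /circle_int.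
have -> : \int[mu]_(t in D) complex.Re ((x +i* y) * f (expi t)) =
    x * \int[mu]_(t in D) complex.Re (f (expi t)) -
    y * \int[mu]_(t in D) complex.Im (f (expi t)).
  rewrite -!RintegralZl // -RintegralB //; last 2 first.
  - by under [X in integrable _ _ X]eq_fun do rewrite /= EFinM; apply: integrableZl.
  - by under [X in integrable _ _ X]eq_fun do rewrite /= EFinM; apply: integrableZl.
  by apply: eq_Rintegral => t _; case: (f _).
have -> : \int[mu]_(t in D) complex.Im ((x +i* y) * f (expi t)) =
    x * \int[mu]_(t in D) complex.Im (f (expi t)) +
    y * \int[mu]_(t in D) complex.Re (f (expi t)).
  rewrite -!RintegralZl // -RintegralD //; last 2 first.
  - by under [X in integrable _ _ X]eq_fun do rewrite /= EFinM; apply: integrableZl.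
  - by under [X in integrable _ _ X]eq_fun do rewrite /= EFinM; apply: integrableZl.
  by apply: eq_Rintegral => t _; case: (f _).
by apply/eqP; rewrite eq_complex /=; apply/andP; split; apply/eqP; ring.
Qed.

(** One factor [z] or [z^-1] is added at a time; on the circle their real and imaginary parts are
    continuous and bounded by 1. *)
Lemma circle_integrable_expz w (e : int) : circle_integrable w ->
  circle_integrable (fun z => z ^ e * w z).
Proof.
move=> w_int.
have step_pos f : circle_integrable f -> circle_integrable (fun z => z * f z).
  apply: (circle_integrableM (h := id)).
  - exact: continuous_cos.
  - exact: continuous_sin.
  by exists 1 => t; rewrite cos_max sin_max.
have step_neg f : circle_integrable f -> circle_integrable (fun z => z^-1 * f z).
  apply: (circle_integrableM (h := fun z => z^-1)).
  - by under eq_fun do rewrite expiV; exact: continuous_cos.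
  - under eq_fun do rewrite expiV; move=> t.
    by apply: continuousN; exact: continuous_sin.
  by exists 1 => t; rewrite expiV /= normrN cos_max sin_max.
case: e => k.
  elim: k => [|k IHk]; first by under eq_fun do rewrite expr0z mul1r.
  apply: eq_circle_integrable (step_pos _ IHk) => t /=.
  by rewrite mulrA -exprS.
elim: k => [|k IHk].
  by apply: eq_circle_integrable (step_neg _ w_int) => t.
apply: eq_circle_integrable (step_neg _ IHk) => t /=.
by rewrite mulrA !NegzE -!exprnN -invfM [in RHS]exprS.
Qed.

(** Common form of the four orthogonality conditions, with [d] equal to 1, -2, 2, -1 for P, Q, R,
    S. *)
Lemma circle_int_horner w p (phi : R[i] -> R[i]) (d e : int) :
  circle_integrable w -> (forall z, phi z = z ^ d) ->
  circle_int (fun z => p.[phi z] * z ^ e * w z) =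
  pair_seq (fun k => fourier_coef w (- (d * k%:Z + e))) p.
Proof.
move=> w_int phiE.
transitivity (circle_int (fun z =>
    \sum_(k < size p) p`_k * (z ^ (d * k%:Z + e) * w z))).
  apply: eq_circle_int => t; rewrite horner_coef !mulr_suml.
  apply: eq_bigr => k _.
  by rewrite phiE exprnP exprz_exp expfzDr ?expi_neq0 // !mulrA.
rewrite /pair_seq; elim: (size p) => [|n IHn].
  rewrite big_ord0 -[RHS](mul0r (circle_int (fun=> 0))) -circle_intZ.
    by apply: eq_circle_int => t; rewrite big_ord0 mul0r.
  exact: circle_integrable0.
have sum_int m : circle_integrable (fun z =>
    \sum_(k < m) p`_k * (z ^ (d * k%:Z + e) * w z)).
  elim: m => [|m IHm].
    by under eq_fun do rewrite big_ord0; apply: circle_integrable0.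
  under eq_fun do rewrite big_ord_recr /=; apply: circle_integrableD => //.
  by apply: circle_integrableZ; apply: circle_integrable_expz.
under eq_fun do rewrite big_ord_recr /=.
rewrite circle_intD; last 2 first.
- exact: sum_int.
- by apply: circle_integrableZ; apply: circle_integrable_expz.
rewrite big_ord_recr /= IHn circle_intZ; last exact: circle_integrable_expz.
by congr (_ + _ * _); rewrite /fourier_coef opprK.
Qed.

End CircleIntegral.

(** * Translation of the polynomials on the circle into orthogonal monic polynomials for
    [bimoment] *)

Section CirclePolynomials.
Context {R : realType} {w : R[i] -> R[i]} (w_int : circle_integrable w).
Implicit Types (p : {poly R[i]}) (n : nat) (r s : int).

Local Notation c := (fourier_coef w).
Local Notation c_opp := (fun k : int => fourier_coef w (- k)).

Lemma P_specE n r p : P_spec w n r p <-> orthogonal_monic (bimoment c r) n p.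
Proof.
have E m : circle_int (fun zeta => p.[zeta] * zeta ^ (- (2 * m%:Z) - r) * w zeta) =
    pair_seq (bimoment c r m) p.
  rewrite (@circle_int_horner _ w p (id) (1)) //.
  by apply: eq_pair_seq => k; congr (fourier_coef w _); lia.
split=> [[[mon_p size_p] orth]|[mon_p size_p orth]]; split=> // m lt_mn.
  by rewrite -E orth.
by rewrite E orth.
Qed.

Lemma Q_specE n r p :
  Q_spec w n r p <-> orthogonal_monic (fun j k => bimoment c r k j) n p.
Proof.
have E m : circle_int (fun zeta => p.[zeta ^- 2] * zeta ^ (m%:Z - r) * w zeta) =
    pair_seq (fun k => bimoment c r k m) p.
  rewrite (@circle_int_horner _ w p (fun z => z ^- 2) (- 2)) //.
  by apply: eq_pair_seq => k; congr (fourier_coef w _); lia.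
split=> [[[mon_p size_p] orth]|[mon_p size_p orth]]; split=> // m lt_mn.
  by rewrite -E orth.
by rewrite E orth.
Qed.

(** Under [k -> - k] and [r = - s], S takes the place of P, and R that of Q. *)
Lemma S_specE n s p :
  S_spec w n s p <-> orthogonal_monic (bimoment c_opp (- s)) n p.
Proof.
have E m : circle_int (fun zeta => p.[zeta^-1] * zeta ^ (2 * m%:Z - s) * w zeta) =
    pair_seq (bimoment c_opp (- s) m) p.
  rewrite (@circle_int_horner _ w p (fun z => z^-1) (- 1)) //.
  by apply: eq_pair_seq => k; congr (fourier_coef w _); lia.
split=> [[[mon_p size_p] orth]|[mon_p size_p orth]]; split=> // m lt_mn.
  by rewrite -E orth.
by rewrite E orth.
Qed.

Lemma R_specE n s p :
  R_spec w n s p <-> orthogonal_monic (fun j k => bimoment c_opp (- s) k j) n p.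
Proof.
have E m : circle_int (fun zeta => p.[zeta ^+ 2] * zeta ^ (- m%:Z - s) * w zeta) =
    pair_seq (fun k => bimoment c_opp (- s) k m) p.
  rewrite (@circle_int_horner _ w p (fun z => z ^+ 2) (2)) //.
  by apply: eq_pair_seq => k; congr (fourier_coef w _); lia.
split=> [[[mon_p size_p] orth]|[mon_p size_p orth]]; split=> // m lt_mn.
  by rewrite -E orth.
by rewrite E orth.
Qed.

Lemma EdetE n s : Edet w n s = gram (bimoment c_opp (- s)) n.
Proof.
rewrite -gram_tr; congr (\det _); apply/matrixP => j k; rewrite !mxE.
by congr (fourier_coef w _); lia.
Qed.

(** The nonzero determinant provides a solution, so [xget] returns a solution and not its
    default. *)
Lemma Ppoly_orthogonal n r : Ddet w n r != 0 ->
  orthogonal_monic (bimoment c r) n (Ppoly w n r).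
Proof.
rewrite -[Ddet w n r]/(gram (bimoment c r) n).
move=> /orthogonal_monic_exists[p p_orth]; apply/P_specE.
by apply: (@xgetPex _ 0 [set p | P_spec w n r p]); exists p; apply/P_specE.
Qed.

Lemma Qpoly_orthogonal n r : Ddet w n r != 0 ->
  orthogonal_monic (fun j k => bimoment c r k j) n (Qpoly w n r).
Proof.
rewrite -[Ddet w n r]/(gram (bimoment c r) n) -gram_tr.
move=> /orthogonal_monic_exists[p p_orth]; apply/Q_specE.
by apply: (@xgetPex _ 0 [set p | Q_spec w n r p]); exists p; apply/Q_specE.
Qed.

Lemma Spoly_orthogonal n s : Edet w n s != 0 ->
  orthogonal_monic (bimoment c_opp (- s)) n (Spoly w n s).
Proof.
rewrite EdetE => /orthogonal_monic_exists[p p_orth]; apply/S_specE.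
by apply: (@xgetPex _ 0 [set p | S_spec w n s p]); exists p; apply/S_specE.
Qed.

Lemma Rpoly_orthogonal n s : Edet w n s != 0 ->
  orthogonal_monic (fun j k => bimoment c_opp (- s) k j) n (Rpoly w n s).
Proof.
rewrite EdetE -gram_tr => /orthogonal_monic_exists[p p_orth]; apply/R_specE.
by apply: (@xgetPex _ 0 [set p | R_spec w n s p]); exists p; apply/R_specE.
Qed.

End CirclePolynomials.

(** * Both identities as instances of [christoffel_darboux] *)

Unset Implicit Arguments.

Theorem theorem5p11 (R : realType) (w : R[i] -> R[i])
    (w_int : circle_integrable w) (n : nat) (r s : int) :
  ((forall m : nat, (1 <= m <= n.+1)%N -> Ddet w m r != 0) ->
   Ddet w n (r + 2) != 0 -> Ddet w n.+1 (r + 2) != 0 ->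
   Ddet w n.+2 (r + 2) != 0 ->
   forall z1 z2 : R[i], z2 != 0 -> z1 ^+ 2 != z2 ^- 2 ->
     Kker w n (z2 ^+ 2) z1 r =
       2^-1 * (Ddet w n (r + 2) / Ddet w n.+1 r)
       * (z2 ^+ (2 * n + 1) / (z1 ^+ 2 - z2 ^- 2))
       * \det (\matrix_(i < 3, j < 3)
                 (Ppoly w (n + j) (r + 2)).[[:: - z2^-1; z2^-1; z1]`_i]))
  /\
  ((forall m : nat, (1 <= m <= n.+1)%N -> Edet w m s != 0) ->
   Edet w n (s - 2) != 0 -> Edet w n.+1 (s - 2) != 0 ->
   Edet w n.+2 (s - 2) != 0 ->
   forall z1 z2 : R[i], z1 != 0 -> z1 ^- 2 != z2 ^+ 2 ->
     Lker w n z2 (z1 ^+ 2) s =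
       2^-1 * (Edet w n (s - 2) / Edet w n.+1 s)
       * (z1 ^+ (2 * n + 1) / (z1 ^- 2 - z2 ^+ 2))
       * \det (\matrix_(i < 3, j < 3)
                 (Spoly w (n + j) (s - 2)).[[:: z1^-1; - z1^-1; z2]`_i])).
Proof.
have seqE (T : nat -> {poly R[i]}) (j : 'I_3) :
    T (n + j)%N = [:: T n; T n.+1; T n.+2]`_j.
  by case: j => [[|[|[|//]]]] ? /=; rewrite ?addn0 ?addn1 ?addn2.
split=> D_n0 D'0 D'1 D'2 z1 z2 z_n0 z12.
  (* The index 0 is added to the hypothesis: the empty determinant is 1. *)
  have D0 m : (m <= n.+1)%N -> gram (bimoment (fourier_coef w) r) m != 0.
    case: m => [_|m le_mn]; last exact: D_n0.
    by rewrite /gram det_mx00 oner_eq0.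
  have P_orth m : Ddet w m (r + 2) != 0 -> orthogonal_monic
      (bimoment (fourier_coef w) (r + 2)) m (Ppoly w m (r + 2)).
    exact: Ppoly_orthogonal.
  have := christoffel_darboux (P := fun j => Ppoly w j r)
    (Q := fun j => Qpoly w j r) D0 D'0 _ _ (P_orth n D'0) (P_orth n.+1 D'1)
    (P_orth n.+2 D'2) z_n0 z12.
  rewrite /Kker => ->; last 2 first.
  - by move=> j le_jn; apply: Ppoly_orthogonal => //; apply: D0; apply: leqW.
  - by move=> j le_jn; apply: Qpoly_orthogonal => //; apply: D0; apply: leqW.
  congr (_ * \det _); apply/matrixP => i j; rewrite !mxE.
  by rewrite (seqE (fun j => Ppoly w j (r + 2))).
have E0 m : (m <= n.+1)%N ->
    gram (bimoment (fun k => fourier_coef w (- k)) (- s)) m != 0.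
  rewrite -EdetE; case: m => [_|m le_mn]; last exact: D_n0.
  by rewrite /Edet det_mx00 oner_eq0.
have s2 : - (s - 2) = - s + 2 by lia.
have S_orth m : Edet w m (s - 2) != 0 -> orthogonal_monic
    (bimoment (fun k => fourier_coef w (- k)) (- s + 2)) m (Spoly w m (s - 2)).
  by rewrite -s2; apply: Spoly_orthogonal.
have gram'_n0 : gram (bimoment (fun k => fourier_coef w (- k)) (- s + 2)) n != 0.
  by rewrite -s2 -EdetE.
(* In the second identity [z1] and [z2] trade places. *)
have z21 : z2 ^+ 2 != z1 ^- 2 by rewrite eq_sym.
have := christoffel_darboux (P := fun j => Spoly w j s)
  (Q := fun j => Rpoly w j s) E0 gram'_n0 _ _ (S_orth n D'0) (S_orth n.+1 D'1)
  (S_orth n.+2 D'2) z_n0 z21.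
rewrite -s2 -!EdetE => CD.
have -> : Lker w n z2 (z1 ^+ 2) s = \sum_(j < n.+1)
    (gram (bimoment (fun k => fourier_coef w (- k)) (- s)) j.+1 /
     gram (bimoment (fun k => fourier_coef w (- k)) (- s)) j)^-1 *
    (Rpoly w j s).[z1 ^+ 2] * (Spoly w j s).[z2].
  by apply: eq_bigr => j _; rewrite /gn !EdetE mulrAC.
rewrite CD; last 2 first.
- move=> j le_jn; apply: Spoly_orthogonal => //; rewrite EdetE.
  by apply: E0; apply: leqW.
- move=> j le_jn; apply: Rpoly_orthogonal => //; rewrite EdetE.
  by apply: E0; apply: leqW.
(* The first two rows are swapped with respect to [christoffel_darboux]; this sign cancels that of
   [z1 ^- 2 - z2 ^+ 2] against [z2 ^+ 2 - z1 ^- 2]. *)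
rewrite (det3E (fun i j => ([:: Spoly w n (s - 2); Spoly w n.+1 (s - 2);
  Spoly w n.+2 (s - 2)]`_j).[[:: - z1^-1; z1^-1; z2]`_i])).
rewrite (det3E (fun i j => (Spoly w (n + j) (s - 2)).[[:: z1^-1; - z1^-1; z2]`_i])).
rewrite /= addn0 !addn1 addn2 -[z2 ^+ 2 - _]opprB invrN.
ring.
Qed.
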